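(* Let $K$ be a field and suppose the Stanley-Reisner ring $R=K[\Delta]$ is a $T$-space. Then the ring $\mathscr D=D(R;K)$ of $K$-linear differential operators on $R$ is generated as an $R$-algebra by the operators $x_i\partial_i^{t}$ with $1\le i\le n$ and $t\in\mathbb N$ ($t\ge 0$). In other words, $$\mathscr D=R\left\langle x_i\partial_i^{t_i}\mid 1\le i\le n,\ t_i\ge 0\right\rangle .$$
   Context: Let $S=K[x_1,\dots,x_n]$. A simplicial complex $\Delta$ on the vertex set $V=\{x_1,\dots,x_n\}$ is a collection of subsets of $V$ (called faces, including $\emptyset$) closed under taking subsets; without loss of generality all singletons $\{x_i\}$ belong to $\Delta$. Facets are the faces maximal under inclusion. The face ideal is $I_\Delta=(x_{i_1}\cdots x_{i_s}\mid \{x_{i_1},\dots,x_{i_s}\}\notin\Delta)\subset S$ and $K[\Delta]=S/I_\Delta$. $\Delta$ (or $K[\Delta]$) is a $T$-space if for every pair of faces $F,G\in\Delta$ with $G\not\subseteq F$ there exists a facet $H$ of $\Delta$ with $F\subseteq H$ and $G\not\subseteq H$. For a $K$-algebra $R$, the $K$-linear differential operators of order $0$ are the multiplications by elements of $R$; a $K$-linear map $\delta:R\to R$ is a differential operator of order $\le t$ if $[\delta,r]=\delta r-r\delta$ is one of order $\le t-1$ for all $r\in R$. $D(R;K)$ is the union over all orders, a ring under composition, containing $R$ as the operators of order $0$. On $S$, the divided power $\partial_i^{t}=\frac1{t!}\frac{\partial^t}{\partial x_i^t}$ (in any characteristic) is the $K[x_1,\dots,\widehat{x_i},\dots,x_n]$-linear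 map with $x_i^v\mapsto\binom{v}{t}x_i^{v-t}$. An operator in $D(S;K)$ mapping $I_\Delta$ into itself induces an operator on $R$; with $\mathscr I(I_\Delta)=\{\delta\in D(S;K)\mid\delta(I_\Delta)\subset I_\Delta\}$ one has $D(R;K)\cong \mathscr I(I_\Delta)/I_\Delta D(S;K)$. The operators $x_i\partial_i^t$ preserve $I_\Delta$ and are regarded as elements of $D(R;K)$. *)

(* Defs.v *)
From HB Require Import structures.
From mathcomp Require Import all_boot all_order all_algebra.
From mathcomp Require Import ssrcomplements.
From mathcomp Require Export mpoly.
From mathcomp Require Import boolp.

Set Implicit Arguments.
Unset Strict Implicit.
Unset Printing Implicit Defensive.

Import GRing.Theory.
Local Open Scope ring_scope.
Local Open Scope quotient_scope.

(* The vertex x_i is encoded by its index i : 'I_n. *)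
Record simplicial_complex (n : nat) := SimplicialComplex {
  faces :> {set {set 'I_n}};
  face0 : set0 \in faces;
  face1 : forall i : 'I_n, [set i] \in faces;
  faceS : forall F G : {set 'I_n}, F \in faces -> G \subset F -> G \in faces
}.

Definition facet (n : nat) (Delta : simplicial_complex n) (H : {set 'I_n}) : bool :=
  maxset (fun F => F \in faces Delta) H.

Definition T_space (n : nat) (Delta : simplicial_complex n) : Prop :=
  forall F G : {set 'I_n}, F \in faces Delta -> G \in faces Delta -> ~~ (G \subset F) ->
  exists H : {set 'I_n}, [/\ facet Delta H, F \subset H & ~~ (G \subset H)].

Section FaceRing.
Variables (K : fieldType) (n : nat) (Delta : simplicial_complex n).
Local Notation S := {mpoly K[n]}.

Definition sqfree_monomial (F : {set 'I_n}) : S := \prod_(i in F) 'X_i.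

Definition in_face_ideal (p : S) : Prop :=
  exists q : {set 'I_n} -> S,
    p = \sum_(F : {set 'I_n} | F \notin faces Delta) q F * sqfree_monomial F.

(* [{ideal_quot _}] requires a boolean predicate. *)
Definition face_ideal : {pred S} := fun p => `[< in_face_ideal p >].

Lemma face_idealP (p : S) : reflect (in_face_ideal p) (p \in face_ideal).
Proof. exact: asboolP. Qed.

Lemma face_ideal_closed : idealr_closed face_ideal.
Proof.
split.
- apply/face_idealP; exists (fun=> 0).
  by rewrite big1 // => F _; rewrite mul0r.
- apply/negP => /face_idealP [q /(congr1 (meval (fun=> 0)))].
  rewrite meval1 raddf_sum big1 => [/eqP|F NF]; first by rewrite oner_eq0.
  have [F0|[i iF]] := set_0Vmem F; first by rewrite F0 face0 in NF.
  rewrite /= rmorphM /sqfree_monomial (bigD1 i) //= rmorphM /= mevalXU.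
  by rewrite mul0r mulr0.
- move=> a u v /face_idealP [qu ->] /face_idealP [qv ->]; apply/face_idealP.
  exists (fun F => a * qu F + qv F).
  rewrite mulr_sumr -big_split /=; apply: eq_bigr => F _.
  by rewrite mulrDl mulrA.
Qed.

HB.instance Definition _ := isIdealr.Build S face_ideal face_ideal_closed.

Definition face_ring : Type := {ideal_quot face_ideal}.

HB.instance Definition _ := GRing.ComNzRing.on face_ring.
HB.instance Definition _ := EqQuotient.on face_ring.

Definition face_proj (p : S) : face_ring := \pi_face_ring p.

Lemma face_proj_eq (p q : S) :
  reflect (face_proj p = face_proj q) (p - q \in face_ideal).
Proof. by rewrite (Quotient.idealrBE face_ideal); exact: eqP. Qed.

Lemma face_proj_surj (f : face_ring) : face_proj (repr f) = f.
Proof. exact: reprK. Qed.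

Lemma face_proj_is_additive : additive face_proj.
Proof. by move=> p q; exact: (raddfB (\pi_{ideal_quot face_ideal})). Qed.

Lemma face_proj_is_multiplicative : multiplicative face_proj.
Proof.
split=> [p q|]; first exact: (rmorphM (\pi_{ideal_quot face_ideal})).
exact: (rmorph1 (\pi_{ideal_quot face_ideal})).
Qed.

HB.instance Definition _ :=
  GRing.isAdditive.Build S face_ring face_proj face_proj_is_additive.
HB.instance Definition _ :=
  GRing.isMultiplicative.Build S face_ring face_proj face_proj_is_multiplicative.

Definition face_scale (c : K) (f : face_ring) : face_ring := face_proj c%:MP * f.

Lemma face_scaleA a b f : face_scale a (face_scale b f) = face_scale (a * b) f.
Proof. by rewrite /face_scale mulrA -rmorphM mpolyCM. Qed.

Lemma face_scale1 : left_id 1 face_scale.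
Proof. by move=> f; rewrite /face_scale rmorph1 mul1r. Qed.

Lemma face_scaleDr : right_distributive face_scale +%R.
Proof. by move=> a f g; rewrite /face_scale mulrDr. Qed.

Lemma face_scaleDl f : {morph face_scale^~ f : a b / a + b}.
Proof. by move=> a b; rewrite /face_scale mpolyCD rmorphD mulrDl. Qed.

HB.instance Definition _ := GRing.Zmodule_isLmodule.Build K face_ring
  face_scaleA face_scale1 face_scaleDr face_scaleDl.

Lemma face_scaleAl (a : K) (f g : face_ring) : a *: (f * g) = (a *: f) * g.
Proof. exact: mulrA. Qed.

HB.instance Definition _ :=
  GRing.Lmodule_isLalgebra.Build K face_ring face_scaleAl.
HB.instance Definition _ := GRing.Lalgebra_isComAlgebra.Build K face_ring.

Lemma face_projZ (c : K) (p : S) : face_proj (c *: p) = c *: face_proj p.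
Proof. by rewrite -mul_mpolyC rmorphM. Qed.

End FaceRing.

Arguments face_ideal K {n} Delta.

Section DiffOp.
Variables (K : fieldType) (R : comAlgType K).

Definition commutator (delta : R -> R) (r : R) : R -> R :=
  fun f => delta (r * f) - r * delta f.

Fixpoint diff_op_le (t : nat) (delta : R -> R) : Prop :=
  match t with
  | 0 => exists r : R, delta =1 *%R r
  | t'.+1 => linear delta /\ forall r : R, diff_op_le t' (commutator delta r)
  end.

Definition diff_op (delta : R -> R) : Prop := exists t, diff_op_le t delta.

(* The ring R<G>: R acts by multiplications, which need not be central; closure
   under negation comes from composing with multiplication by -1. *)
Inductive generated (G : (R -> R) -> Prop) : (R -> R) -> Prop :=
| gen_mul (r : R) : generated G ( *%R r)
| gen_op (delta : R -> R) : G delta -> generated G delta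
| gen_add (d1 d2 : R -> R) :
    generated G d1 -> generated G d2 -> generated G (d1 \+ d2)
| gen_comp (d1 d2 : R -> R) :
    generated G d1 -> generated G d2 -> generated G (d1 \o d2)
| gen_ext (d1 d2 : R -> R) : d1 =1 d2 -> generated G d1 -> generated G d2.

End DiffOp.

Section DividedPower.
Variables (K : fieldType) (n : nat).
Local Notation S := {mpoly K[n]}.
Implicit Types (i : 'I_n) (t : nat).

(* The monomial subtraction is truncated, but the binomial coefficient vanishes
   when m i < t. *)
Definition divided_partial i t (p : S) : S :=
  \sum_(m <- msupp p) (p@_m *+ 'C(m i, t)) *: 'X_[m - U_(i) *+ t].

Lemma divided_partialwE i t (p : S) k : (msize p <= k)%N ->
  divided_partial i t p =
  \sum_(m : 'X_{1..n < k}) (p@_m *+ 'C(m i, t)) *: 'X_[m - U_(i) *+ t].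
Proof.
pose I : subFinType _ := 'X_{1..n < k}.
move=> le_pk; rewrite /divided_partial (big_mksub I) /=; first last.
+ by move=> m /msize_mdeg_lt/leq_trans/(_ le_pk) ->.
+ by rewrite msupp_uniq.
rewrite big_rmcond //= => m /memN_msupp_eq0 ->.
by rewrite mul0rn scale0r.
Qed.

Lemma divided_partial_is_linear i t : linear (divided_partial i t).
Proof.
move=> c p q; pose k := maxn (msize p) (maxn (msize q) (msize (c *: p + q))).
rewrite !(@divided_partialwE _ _ _ k) ?leq_max ?leqnn ?orbT //.
rewrite scaler_sumr -big_split /=; apply: eq_bigr => m _.
by rewrite scalerA -scalerDl mcoeffD mcoeffZ mulrnDl mulrnAr.
Qed.

HB.instance Definition _ i t := GRing.isLinear.Build K S S _
  (divided_partial i t) (divided_partial_is_linear i t).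

Lemma divided_partialX i t (m : 'X_{1..n}) :
  divided_partial i t 'X_[m] = 'X_[m - U_(i) *+ t] *+ 'C(m i, t).
Proof.
by rewrite /divided_partial msuppX big_seq1 mcoeffX eqxx scaler_nat.
Qed.

Definition x_divided_partial i t (p : S) : S := 'X_i * divided_partial i t p.

Lemma x_divided_partial_is_linear i t : linear (x_divided_partial i t).
Proof. by move=> c p q; rewrite /x_divided_partial linearP mulrDr scalerAr. Qed.

HB.instance Definition _ i t := GRing.isLinear.Build K S S _
  (x_divided_partial i t) (x_divided_partial_is_linear i t).

End DividedPower.

Section Induced.
Variables (K : fieldType) (n : nat) (Delta : simplicial_complex n).
Local Notation S := {mpoly K[n]}.
Local Notation R := (face_ring K Delta).

Lemma sqfree_monomialE (F : {set 'I_n}) :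
  sqfree_monomial K F = 'X_[\sum_(i in F) U_(i)].
Proof. exact/esym/(big_morph _ (@mpolyXD n K) (@mpolyX0 n K)). Qed.

Lemma sqfree_mnmE (F : {set 'I_n}) j :
  (\sum_(i in F) U_(i))%MM j = (j \in F) :> nat.
Proof.
rewrite mnm_sumE; case: (boolP (j \in F)) => jF.
  rewrite (bigD1 j) //= mnm1E eqxx big1 // => i /andP[_ /negPf].
  by rewrite mnm1E => ->.
rewrite big1 // => i iF; rewrite mnm1E; case: eqP => // ij.
by rewrite -ij iF in jF.
Qed.

Lemma sqfree_face_ideal (F : {set 'I_n}) :
  F \notin faces Delta -> sqfree_monomial K F \in face_ideal K Delta.
Proof.
move=> NF; apply/face_idealP; exists (fun G => (G == F)%:R).
rewrite (bigD1 F) //= eqxx mul1r big1 ?addr0 // => G /andP[_ /negPf ->].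
by rewrite mul0r.
Qed.

Lemma x_divided_partial_face_ideal (i : 'I_n) t (p : S) :
  p \in face_ideal K Delta -> x_divided_partial i t p \in face_ideal K Delta.
Proof.
case/face_idealP => q ->; rewrite linear_sum /=; apply: rpred_sum => F NF.
rewrite [q F]mpolyE mulr_suml linear_sum; apply: rpred_sum => m _ /=.
rewrite -scalerAl linearZ /= -mul_mpolyC; apply: idealMr.
rewrite sqfree_monomialE -mpolyXD /= /x_divided_partial divided_partialX.
set M := (m + _)%MM; rewrite mulrnAr.
have [ltMt|letM] := ltnP (M i) t; first by rewrite bin_small // mulr0n rpred0.
apply: rpredMn; rewrite -mpolyXD.
set mF := (\sum_(j in F) U_(j))%MM in M letM *.
have le_mF : (mF <= U_(i) + (M - U_(i) *+ t))%MM.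
  apply/mnm_lepP => j; rewrite sqfree_mnmE; case: (boolP (j \in F)) => // jF.
  rewrite mnmDE mnmBE mulmnE mnm1E; case: eqP => [_|_] //=.
  by rewrite mul0n subn0 mnmDE sqfree_mnmE jF addn1.
rewrite -(submK le_mF) mpolyXD; apply: idealMr.
by rewrite -sqfree_monomialE sqfree_face_ideal.
Qed.

(* Meaningful only for additive P preserving the face ideal, see [inducedE];
   otherwise it depends on the choice of representatives. *)
Definition induced (P : S -> S) (f : R) : R := face_proj Delta (P (repr f)).

Lemma inducedE (P : {additive S -> S}) :
  (forall p, p \in face_ideal K Delta -> P p \in face_ideal K Delta) ->
  forall p, induced P (face_proj Delta p) = face_proj Delta (P p).
Proof.
move=> PI p; apply/face_proj_eq; rewrite -raddfB; apply: PI.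
by apply/face_proj_eq; rewrite face_proj_surj.
Qed.

Definition x_divided_partial_face (i : 'I_n) (t : nat) : R -> R :=
  induced (x_divided_partial i t).

Lemma x_divided_partial_faceE (i : 'I_n) t (p : S) :
  x_divided_partial_face i t (face_proj Delta p) = face_proj Delta (x_divided_partial i t p).
Proof. exact: inducedE (@x_divided_partial_face_ideal i t) p. Qed.

End Induced.

Arguments x_divided_partial_face K {n} Delta i t.

(* Main.v *)
Require Import Defs.
From HB Require Import structures.
From mathcomp Require Import all_boot all_order all_algebra.
From mathcomp Require Import boolp.

(** Why the theorem holds.  Write [x^m] for the class of a monomial in the face
    ring [R]; it vanishes exactly when the support of [m] is not a face.

    A differential operator is controlled by its symbols: for a word [w] in the
    variables, the iterated commutator of [delta] with the variables of [w],
    evaluated at 1.  The symbol depends only on the exponent [b] of [w], since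
    commutators with commuting elements commute ([iter_commutator_perm]), it
    vanishes for long words ([iter_commutator_long]), and an operator all of
    whose symbols vanish is zero ([diff_op_eq0]): by induction on the order it
    commutes with every variable, so it is multiplication by its value at 1.
    Formally the symbol [r_b] is the coefficient of the divided power operator
    of exponent [b], although those operators need not preserve the face ideal.

    The symbols are constrained as follows.  If [H] is a facet then [x^H] kills
    the variables outside [H], and since [R] is reduced every differential
    operator preserves the annihilator of [x^H] ([diff_op_ann]).  Commuting with
    a variable outside [H] thus produces an operator with values in that
    annihilator, so [x^H r_b = 0] as soon as the support of [b] is not
    contained in [H] ([facet_kills_commutator]).  In a T-space this says that
    every monomial of [r_b] is divisible by the product of the variables in the
    support of [b]: if a face [c] does not contain that support, some
    facet [H] contains [c] but not the support, and [x^H x^c] is nonzero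
    ([T_space_divisible]).  Hence [r_b = s_b x^(supp b)] for some [s_b] in [R].

    Finally, the composite of the [x_i partial_i^(b_i)] over the support of [b]
    has a single nonzero symbol, namely [x^(supp b)] at the exponent [b]
    ([acts_like_var_commutator], [euler_op_acts_like]).  So [delta] and the
    finite sum of the [s_b] times these composites have the same symbols, and
    are equal.  Conversely differential operators are closed under sums and
    composites, and an operator with the shape of [z partial^b] has order at
    most the degree of [b] ([acts_like_diff_op]). *)

Set Implicit Arguments.
Unset Strict Implicit.
Unset Printing Implicit Defensive.

Import GRing.Theory.
Local Open Scope ring_scope.

(** * Folding an operation that does not depend on the order *)

Section FoldlRightCommutative.
Variables (A : Type) (I : eqType) (f : A -> I -> A).
Hypothesis fAC : forall a i j, f (f a i) j = f (f a j) i.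

Lemma foldl_perm_eq s1 s2 a : perm_eq s1 s2 -> foldl f a s1 = foldl f a s2.
Proof.
elim: s1 s2 a => [|i s1 IH] s2 a ps.
  by move: ps; rewrite perm_sym => /perm_nilP ->.
have is2 : i \in s2 by rewrite -(perm_mem ps) mem_head.
case/splitPr: s2 / is2 ps => p q.
rewrite perm_sym perm_catC /= perm_cons perm_catC perm_sym => /IH -> /=.
elim: p a => //= j p IHp a.
by rewrite fAC IHp.
Qed.

End FoldlRightCommutative.

(** * Differential operators on a commutative algebra *)

Section DifferentialOperators.
Variables (K : fieldType) (R : comAlgType K).
Local Notation comm := (commutator (K := K)).
Local Notation order_le := (diff_op_le (K := K)).
Implicit Types (d e : R -> R) (r s f g : R) (t u : nat).

Lemma mul_linear r : linear ( *%R r : R -> R).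
Proof. by move=> c f g; rewrite mulrDr scalerAr. Qed.

Lemma zero_fun_linear : linear (fun _ : R => 0 : R).
Proof. by move=> c f g; rewrite scaler0 addr0. Qed.

Lemma linear_comp_fun d e : linear d -> linear e -> linear (d \o e).
Proof. by move=> dL eL c f g /=; rewrite eL dL. Qed.

Lemma linear_add_fun d e : linear d -> linear e -> linear (d \+ e).
Proof. by move=> dL eL c f g /=; rewrite dL eL scalerDr addrACA. Qed.

Lemma linear_fun0 d : linear d -> d 0 = 0.
Proof. by move=> dL; move: (dL (-1) 0 0); rewrite scaler0 addr0 scaleN1r addNr. Qed.

Lemma linear_funD d : linear d -> {morph d : f g / f + g}.
Proof. by move=> dL f g; move: (dL 1 f g); rewrite !scale1r. Qed.

Lemma linear_funB d : linear d -> {morph d : f g / f - g}.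
Proof. by move=> dL f g; rewrite -scaleN1r addrC dL scaleN1r addrC. Qed.

Lemma linear_funZ d : linear d -> forall c f, d (c *: f) = c *: d f.
Proof. by move=> dL c f; move: (dL c f 0); rewrite (linear_fun0 dL) !addr0. Qed.

Lemma linear_fun_sum d : linear d -> forall (I : Type) (l : seq I) F,
  d (\sum_(i <- l) F i) = \sum_(i <- l) d (F i).
Proof.
by move=> dL I l F; exact: (big_morph d (linear_funD dL) (linear_fun0 dL)).
Qed.

Lemma commutator_linear d r : linear d -> linear (comm d r).
Proof.
move=> dL c f g; rewrite /commutator mulrDr -scalerAr !dL mulrDr -scalerAr.
by rewrite scalerBr opprD addrACA.
Qed.

Lemma diff_op_linear t d : order_le t d -> linear d.
Proof.
case: t => [[r dr]|t []] //.
by move=> c f g; rewrite !dr mul_linear.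
Qed.

Lemma diff_op_ext t d e : d =1 e -> order_le t d -> order_le t e.
Proof. by move/funext => ->. Qed.

Lemma diff_op0 t : order_le t (fun _ : R => 0).
Proof.
elim: t => [|t IH]; first by exists 0 => f; rewrite mul0r.
split=> [|r]; first exact: zero_fun_linear.
by apply: diff_op_ext IH => f; rewrite /commutator mulr0 subr0.
Qed.

Lemma diff_op_le_S t d : order_le t d -> order_le t.+1 d.
Proof.
elim: t d => [|t IH] d dt; split; try exact: diff_op_linear dt.
  case: dt => s ds r; apply: diff_op_ext (diff_op0 0) => f.
  by rewrite /commutator !ds mulrCA subrr.
by move=> r; apply: IH; exact: dt.2.
Qed.

Lemma diff_op_le_trans t u d : (t <= u)%N -> order_le t d -> order_le u d.
Proof.
move=> /subnK <-; elim: (u - t)%N => // k IH dt.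
by rewrite addSn; apply/diff_op_le_S/IH.
Qed.

Lemma diff_op_add t d e : order_le t d -> order_le t e -> order_le t (d \+ e).
Proof.
elim: t d e => [|t IH] d e.
  by move=> [r dr] [s es]; exists (r + s) => f /=; rewrite dr es mulrDl.
move=> [dL dt] [eL et]; split; first exact: linear_add_fun.
move=> r; apply: diff_op_ext (IH _ _ (dt r) (et r)) => f /=.
by rewrite /commutator /= mulrDr opprD addrACA.
Qed.

Lemma commutator_comp d e r : linear d ->
  comm (d \o e) r =1 (comm d r \o e) \+ (d \o comm e r).
Proof.
by move=> dL f; rewrite /commutator /= (linear_funB dL) [RHS]addrC addrA subrK.
Qed.

(** By the Leibniz rule [commutator_comp], a commutator of the composite is a sum
    of two composites of smaller total order, so the induction is on the sum of
    the orders; an operator of order 0 has zero commutators and leaves one term. *)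
Lemma diff_op_comp t u d e :
  order_le t d -> order_le u e -> order_le (t + u) (d \o e).
Proof.
move: {2}(t + u)%N (leqnn (t + u)) => k.
elim: k t u d e => [|k IH] t u d e.
  rewrite leqn0 addn_eq0 => /andP [/eqP -> /eqP ->] [r dr] [s es].
  by exists (r * s) => f /=; rewrite es dr mulrA.
move=> le_k dt eu.
have dL := diff_op_linear dt; have eL := diff_op_linear eu.
case: t dt le_k => [|t] dt.
  case: dt => r /funext ->; rewrite add0n => le_k.
  case: u eu le_k => [[s /funext -> _]|u eu le_k].
    by exists (r * s) => f /=; rewrite mulrA.
  split=> [|s]; first exact: linear_comp_fun (mul_linear r) eL.
  apply: diff_op_ext (IH 0%N u _ _ le_k (ex_intro _ r (frefl _)) (eu.2 s)) => f /=.
  by rewrite /commutator /= mulrBr (mulrCA s).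
rewrite addSn => le_k; split=> [|r]; first exact: linear_comp_fun.
apply: diff_op_ext (fun f => esym (commutator_comp e r dL f)) _.
apply: diff_op_add; first by apply: IH => //; exact: dt.2.
case: u eu le_k => [[s /funext ->] _|u eu le_k].
  apply: diff_op_ext (diff_op0 _) => f /=.
  by rewrite /commutator mulrCA subrr (linear_fun0 dL).
by rewrite addnS -addSn; apply: IH => //; [rewrite addSn -addnS | exact: eu.2].
Qed.

Lemma generated_diff_op (G : (R -> R) -> Prop) d :
  (forall e, G e -> diff_op (K := K) e) -> generated (K := K) G d ->
  diff_op (K := K) d.
Proof.
move=> GD; elim=> {d} [r|d /GD //|d e _ [t dt] _ [u eu]|d e _ [t dt] _ [u eu]|d e de _ [t dt]].
- by exists 0%N, r.
- exists (maxn t u); apply: diff_op_add.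
    exact: diff_op_le_trans (leq_maxl _ _) dt.
  exact: diff_op_le_trans (leq_maxr _ _) eu.
- by exists (t + u)%N; exact: diff_op_comp.
- by exists t; exact: diff_op_ext de dt.
Qed.

(** With [diff_op_commutator_lin], this makes the elements whose commutator with
    [d] has order at most [t] into a subalgebra, so that the order of [d] can be
    tested on algebra generators. *)
Lemma diff_op_commutatorM t d r s :
  order_le t (comm d r) -> order_le t (comm d s) -> order_le t (comm d (r * s)).
Proof.
move=> dr ds; have mul0 q : order_le 0 ( *%R q : R -> R) by exists q.
have := diff_op_comp (mul0 r) ds; have := diff_op_comp dr (mul0 s).
rewrite addn0 add0n => drs rds; apply: diff_op_ext (diff_op_add drs rds) => f /=.
by rewrite /commutator mulrBr !mulrA addrA subrK.
Qed.

Lemma diff_op_commutator_lin t d c r s : linear d ->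
  order_le t (comm d r) -> order_le t (comm d s) ->
  order_le t (comm d (c *: r + s)).
Proof.
move=> dL dr ds.
have mulc : order_le 0 ( *%R c%:A : R -> R) by exists c%:A.
apply: diff_op_ext (diff_op_add (diff_op_comp mulc dr) ds) => f /=.
rewrite /commutator mulr_algl mulrDl (linear_funD dL) -scalerAl (linear_funZ dL).
by rewrite mulrDl opprD addrACA scalerBr scalerAl.
Qed.

Lemma commutatorAC d r s : comm (comm d r) s = comm (comm d s) r.
Proof.
apply: funext => f; rewrite /commutator !mulrBr !opprB !addrA.
rewrite !(mulrA r) !(mulrA s) (mulrC r s).
by rewrite addrAC [RHS]addrAC; congr (_ + _); rewrite addrAC.
Qed.

Section IteratedCommutator.
Variables (I : eqType) (x : I -> R).
Implicit Type w : seq I.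

Definition iter_commutator d w : R -> R := foldl (fun e i => comm e (x i)) d w.

Lemma iter_commutator_perm d w v :
  perm_eq w v -> iter_commutator d w = iter_commutator d v.
Proof. by apply: foldl_perm_eq => e i j; exact: commutatorAC. Qed.

Lemma iter_commutatorB d e w :
  iter_commutator (fun f => d f - e f) w =
  (fun f => iter_commutator d w f - iter_commutator e w f).
Proof.
elim: w d e => //= i w IH d e; rewrite -IH; congr iter_commutator.
by apply: funext => f; rewrite /commutator mulrBr opprD addrACA -opprD.
Qed.

Lemma iter_commutator_sum (J : Type) (l : seq J) (c : J -> R) (e : J -> R -> R) w :
  iter_commutator (fun f => \sum_(j <- l) c j * e j f) w =
  (fun f => \sum_(j <- l) c j * iter_commutator (e j) w f).
Proof.
elim: w e => //= i w IH e; rewrite -IH; congr iter_commutator.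
apply: funext => f; rewrite /commutator mulr_sumr -sumrB; apply: eq_bigr => j _.
by rewrite mulrBr (mulrCA (c j)).
Qed.

Lemma iter_commutator_long t d w : (t < size w)%N ->
  order_le t d -> iter_commutator d w =1 (fun=> 0).
Proof.
have ad0 v : iter_commutator (fun=> 0) v = fun=> 0.
  elim: v => //= i v IH; rewrite -[RHS]IH; congr iter_commutator.
  by apply: funext => f; rewrite /commutator mulr0 subr0.
elim: t d w => [|t IH] d [|i w] //=.
  move=> _ [r /funext ->] f; rewrite -[RHS](congr1 (@^~ f) (ad0 w)).
  congr (iter_commutator _ w f); apply: funext => g.
  by rewrite /commutator mulrCA subrr.
by rewrite ltnS => ltw [_ dt]; apply: IH ltw (dt _).
Qed.

End IteratedCommutator.

(** If [y f = 0] then the commutator of [d] with [y] sends [f] to [- y d(f)]; by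
    induction on the order this is again killed by [y], so that [y^2 d(f) = 0],
    and the annihilators of [y^2] and [y] coincide by assumption. *)
Lemma diff_op_ann t d y f : order_le t d ->
  (forall g, y * (y * g) = 0 -> y * g = 0) -> y * f = 0 -> y * d f = 0.
Proof.
move=> dt yred; elim: t d dt => [|t IH] d.
  by case=> r dr yf; rewrite dr mulrCA yf mulr0.
move=> [dL dt] yf; have := IH _ (dt y) yf.
rewrite /commutator yf (linear_fun0 dL) sub0r mulrN => /eqP.
by rewrite oppr_eq0 => /eqP /yred.
Qed.

End DifferentialOperators.

(** * Supports, words and binomials of exponents *)

Section Exponents.
Variable n : nat.
Implicit Types (a b c m : 'X_{1..n}) (F : {set 'I_n}) (w : seq 'I_n).

Definition mnm_supp m : {set 'I_n} := [set i | m i != 0%N].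

Definition mnm_indic F : 'X_{1..n} := (\sum_(i in F) U_(i))%MM.

Lemma mnm_suppD a b : mnm_supp (a + b) = mnm_supp a :|: mnm_supp b.
Proof. by apply/setP => i; rewrite !inE mnmDE addn_eq0 negb_and. Qed.

Lemma mnm_supp_indic F : mnm_supp (mnm_indic F) = F.
Proof. by apply/setP => i; rewrite inE sqfree_mnmE eqb0 negbK. Qed.

Lemma mnm_indic_le F m : F \subset mnm_supp m -> (mnm_indic F <= m)%MM.
Proof.
move=> /subsetP Fm; apply/mnm_lepP => i; rewrite sqfree_mnmE.
by case: (boolP (i \in F)) => // /Fm; rewrite inE lt0n.
Qed.

Lemma mnm_varK b i : b i != 0%N -> (U_(i) + (b - U_(i)) = b)%MM.
Proof. by move=> bi; rewrite addmC submK // lep1mP. Qed.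

Lemma mnm_neq0 b : b != 0%MM -> exists i, b i != 0%N.
Proof.
move=> b0; apply/existsP; apply: contraR b0 => /existsPn b0.
by apply/eqP/mnmP => i; rewrite mnm0E; have := b0 i; rewrite negbK => /eqP.
Qed.

Lemma mnm_ind (P : 'X_{1..n} -> Prop) :
  P 0%MM -> (forall i m, P m -> P (U_(i) + m)%MM) -> forall m, P m.
Proof.
move=> P0 PS m; elim: (mdeg m) {-2}m (erefl (mdeg m)) => {m} [|k IH] m mk.
  by move/eqP: mk; rewrite mdeg_eq0 => /eqP ->.
have [i mi] : exists i, m i != 0%N.
  by apply: mnm_neq0; rewrite -mdeg_eq0 mk.
rewrite -(mnm_varK mi); apply: PS; apply: IH.
by move: mk; rewrite -{1}(mnm_varK mi) mdegD mdeg1 add1n => -[].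
Qed.

Definition word_mnm w : 'X_{1..n} := (\sum_(i <- w) U_(i))%MM.

Definition mnm_word b : seq 'I_n := flatten [seq nseq (b i) i | i <- enum 'I_n].

Lemma mdeg_word_mnm w : mdeg (word_mnm w) = size w.
Proof. by rewrite mdeg_sum; under eq_bigr do rewrite mdeg1; rewrite sum1_size. Qed.

Lemma perm_mnm_word w : perm_eq w (mnm_word (word_mnm w)).
Proof.
apply/allP => i _ /=; rewrite /mnm_word count_flatten -map_comp.
rewrite sumnE big_map big_enum (bigD1 i) //= big1 ?addn0 => [|j /negPf ji].
  rewrite count_nseq /= eqxx mul1n /word_mnm mnm_sumE -sum1_count.
  rewrite big_mkcond; apply/eqP; apply: eq_bigr => j _.
  by rewrite mnm1E /=; case: (j == i).
by rewrite count_nseq /= ji.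
Qed.

Lemma mem_mnm_word b i : b i != 0%N -> i \in mnm_word b.
Proof.
move=> bi; apply/flattenP; exists (nseq (b i) i); last by rewrite mem_nseq lt0n bi eqxx.
by apply: map_f; rewrite mem_enum.
Qed.

Definition mnm_bin a b : nat := \prod_(i < n) 'C(a i, b i).

Lemma mnm_bin0 a : mnm_bin a 0%MM = 1%N.
Proof. by rewrite /mnm_bin big1 // => i _; rewrite mnm0E bin0. Qed.

Lemma mnm_binD1 i a b :
  mnm_bin a b = ('C(a i, b i) * \prod_(j < n | j != i) 'C(a j, b j))%N.
Proof. by rewrite /mnm_bin (bigD1 i). Qed.

Lemma mnm_binS a b i :
  mnm_bin (U_(i) + a) (U_(i) + b) = (mnm_bin a (U_(i) + b) + mnm_bin a b)%N.
Proof.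
have off m j : j != i -> (U_(i) + m)%MM j = m j.
  by move=> /negPf ji; rewrite mnmDE mnm1E eq_sym ji.
rewrite !(mnm_binD1 i) !mnmDE mnm1E eqxx !add1n binS mulnDl.
by congr (_ * _ + _ * _)%N; apply: eq_bigr => j ji; rewrite !off.
Qed.

Lemma mnm_bin_var a b i : b i = 0%N -> mnm_bin (U_(i) + a) b = mnm_bin a b.
Proof.
move=> bi; apply: eq_bigr => j _; rewrite mnmDE mnm1E.
by case: eqP => // <-; rewrite bi !bin0.
Qed.

Lemma mnm_bin_small i a b : (a i < b i)%N -> mnm_bin a b = 0%N.
Proof. by move=> ab; rewrite (mnm_binD1 i) bin_small. Qed.

End Exponents.

(** * Monomials in the face ring *)

Section FaceRingMonomials.
Variables (K : fieldType) (n : nat) (Delta : simplicial_complex n).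
Local Notation S := {mpoly K[n]}.
Local Notation R := (face_ring K Delta).
Local Notation proj := (face_proj Delta).
Implicit Types (m a b c : 'X_{1..n}) (F H : {set 'I_n}) (p : S) (f r : R).

Definition face_monomial m : R := proj 'X_[m].

Lemma face_monomialD a b : face_monomial (a + b) = face_monomial a * face_monomial b.
Proof. by rewrite /face_monomial mpolyXD rmorphM. Qed.

Lemma face_monomial0 : face_monomial 0%MM = 1.
Proof. by rewrite /face_monomial mpolyX0 rmorph1. Qed.

Lemma monomial_face_ideal m :
  mnm_supp m \notin faces Delta -> 'X_[m] \in face_ideal K Delta.
Proof.
move=> NF; rewrite -(submK (mnm_indic_le (subxx (mnm_supp m)))) mpolyXD.
by apply: idealMr; rewrite -sqfree_monomialE sqfree_face_ideal.
Qed.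

(** The face ideal is a monomial ideal, so membership is read off the
    coefficients; equivalently the monomials supported on faces are a basis of
    the face ring. *)
Lemma face_ideal_coeffP p :
  p \in face_ideal K Delta <-> (forall m, mnm_supp m \in faces Delta -> p@_m = 0).
Proof.
split=> [/face_idealP [q ->] m mD|p0].
  rewrite raddf_sum big1 //= => F NF.
  rewrite sqfree_monomialE [q F]mpolyE mulr_suml raddf_sum big1 //= => a _.
  rewrite -scalerAl -mpolyXD mcoeffZ mcoeffX; case: eqP => [am|]; last by rewrite mulr0.
  case/negP: NF; apply: faceS mD _.
  by rewrite -am mnm_suppD -/(mnm_indic F) mnm_supp_indic subsetUr.
rewrite [p]mpolyE; apply: rpred_sum => m _.
have [/p0 ->|NF] := boolP (mnm_supp m \in faces Delta); first by rewrite scale0r rpred0.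
by rewrite -mul_mpolyC; apply: idealMr; exact: monomial_face_ideal.
Qed.

Lemma face_proj_eq0 p : proj p = 0 <-> p \in face_ideal K Delta.
Proof.
rewrite -[X in X \in _]subr0 -(rmorph0 proj).
by split=> /face_proj_eq.
Qed.

Lemma face_monomial_eq0 m : mnm_supp m \notin faces Delta -> face_monomial m = 0.
Proof. by move=> NF; apply/face_proj_eq0/monomial_face_ideal. Qed.

Lemma face_projE p : proj p = \sum_(m <- msupp p) p@_m *: face_monomial m.
Proof. by rewrite {1}[p]mpolyE raddf_sum; apply: eq_bigr => m _; exact: face_projZ. Qed.

Lemma linear_eq_monomials (d e : R -> R) : linear d -> linear e ->
  (forall m, d (face_monomial m) = e (face_monomial m)) -> d = e.
Proof.
move=> dL eL de; apply: funext => f; rewrite -[f]face_proj_surj face_projE.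
rewrite (linear_fun_sum dL) (linear_fun_sum eL).
by apply: eq_bigr => m _; rewrite (linear_funZ dL) (linear_funZ eL) de.
Qed.

(** Multiplying a monomial by [x^m] once or twice gives the same support, hence
    both products vanish or neither does.  This is how the reducedness of [R]
    enters in [diff_op_ann]. *)
Lemma face_monomial_reduced m f :
  face_monomial m * (face_monomial m * f) = 0 -> face_monomial m * f = 0.
Proof.
rewrite -[f]face_proj_surj /face_monomial -!rmorphM; set p := repr f.
move=> /face_proj_eq0/face_ideal_coeffP p0; apply/face_proj_eq0/face_ideal_coeffP => c cD.
have [lemc|Nmc] := boolP (m <= c)%MM.
  have := p0 (m + c)%MM; rewrite ['X_[m] * (_ * _)]mulrC mcoeffMX; apply.
  by rewrite -(submK lemc) !mnm_suppD setUCA setUid -mnm_suppD submK.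
rewrite [p]mpolyE mulr_sumr raddf_sum big1 //= => a _.
rewrite -scalerAr -mpolyXD mcoeffZ mcoeffX; case: eqP => [E|]; last by rewrite mulr0.
by case/negP: Nmc; rewrite -E lem_addr.
Qed.

Lemma face_monomial_mul_coeff0 a p c : face_monomial a * proj p = 0 ->
  mnm_supp (a + c) \in faces Delta -> p@_c = 0.
Proof.
rewrite -rmorphM => /face_proj_eq0/face_ideal_coeffP p0 /p0.
by rewrite mulrC mcoeffMX.
Qed.

Lemma facet_monomial_kills H i : facet Delta H -> i \notin H ->
  face_monomial (mnm_indic H) * face_monomial U_(i) = 0.
Proof.
move=> /maxsetP [HD Hmax] iH; rewrite -face_monomialD; apply: face_monomial_eq0.
apply/negP; rewrite mnm_suppD mnm_supp_indic => /Hmax /(_ (subsetUl _ _)) E.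
by move: iH; rewrite -E !inE mnm1E eqxx orbT.
Qed.

(** * Constraints on the symbols of a differential operator *)

Definition var_commutator :=
  iter_commutator (K := K) (fun i : 'I_n => face_monomial U_(i)).

(** Both terms of the commutator of [e] with a variable outside [H] are killed by
    [x^H], the second one because [e] preserves the annihilator of [x^H]; taking
    further commutators keeps the values inside this annihilator. *)
Lemma facet_kills_commutator t d w H i : diff_op_le (K := K) t d ->
  facet Delta H -> i \notin H -> i \in w ->
  forall f, face_monomial (mnm_indic H) * var_commutator d w f = 0.
Proof.
move=> dt HH iH; set y := face_monomial _.
have stab v e : (forall f, y * e f = 0) -> forall f, y * var_commutator e v f = 0.
  elim: v e => //= j v IH e ye; apply: IH => f.
  by rewrite /commutator mulrBr ye mulrCA ye mulr0 subr0.
elim: w t d dt => //= j w IH t d dt; rewrite inE.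
have yann e u f : diff_op_le (K := K) u e -> y * f = 0 -> y * e f = 0.
  by move=> eu; apply: (diff_op_ann eu) => g; exact: face_monomial_reduced.
case: eqP => [<- _|_ /= iw].
  apply: stab => f; have yi : y * face_monomial U_(i) = 0 by exact: facet_monomial_kills.
  rewrite /commutator mulrBr mulrA yi mul0r subr0.
  by apply: (yann _ _ _ dt); rewrite mulrA yi mul0r.
by have [_ adt] := diff_op_le_S dt; exact: IH (adt _) iw.
Qed.

(** A monomial [x^c] of [r] with [supp b] not inside the face [supp c] would
    survive multiplication by [x^H], for a facet [H] containing [supp c] but not
    [supp b]; such a facet comes from the T-space condition if [supp b] is a
    face, and any facet above [supp c] will do otherwise. *)
Lemma T_space_divisible b r : T_space Delta ->
  (forall H, facet Delta H -> ~~ (mnm_supp b \subset H) ->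
     face_monomial (mnm_indic H) * r = 0) ->
  exists s, r = s * face_monomial (mnm_indic (mnm_supp b)).
Proof.
move=> hT kill; rewrite -[r]face_proj_surj; set p := repr r.
set B := mnm_supp b; exists (\sum_(c <- msupp p | mnm_supp c \in faces Delta)
   p@_c *: face_monomial (c - mnm_indic B)).
rewrite face_projE (bigID (fun c => mnm_supp c \in faces Delta)) /= [X in _ + X]big1 ?addr0.
  rewrite mulr_suml big_seq_cond [RHS]big_seq_cond; apply: eq_bigr => c /andP [cp cD].
  rewrite -scalerAl -face_monomialD submK //; apply: mnm_indic_le; apply/idPn => NBc.
  have [H [HH cH NBH]] : exists H, [/\ facet Delta H, mnm_supp c \subset H & ~~ (B \subset H)].
    have [BD|NBD] := boolP (B \in faces Delta); first exact: hT.
    have [H HH cH] := maxset_exists (P := fun F => F \in faces Delta) cD.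
    exists H; split=> //; apply: contra NBD => BH; apply: faceS BH.
    by case/maxsetP: HH.
  move: cp; rewrite mcoeff_msupp; case/eqP.
  apply: face_monomial_mul_coeff0 (_ : face_monomial (mnm_indic H) * _ = 0) _.
    by rewrite face_proj_surj; exact: kill.
  rewrite mnm_suppD mnm_supp_indic (setUidPl cH).
  by case/maxsetP: HH.
by move=> c /face_monomial_eq0 ->; rewrite scaler0.
Qed.

Lemma diff_op_le_vars t (d : R -> R) : linear d ->
  (forall i, diff_op_le (K := K) t (commutator (K := K) d (face_monomial U_(i)))) ->
  diff_op_le (K := K) t.+1 d.
Proof.
move=> dL dX; split=> // r; rewrite -[r]face_proj_surj face_projE.
have d0 : diff_op_le (K := K) t (commutator (K := K) d 0).
  apply: diff_op_ext (diff_op0 _ t) => f.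
  by rewrite /commutator !mul0r (linear_fun0 dL) subr0.
elim: (msupp _) => [|m s IH]; rewrite ?big_nil // big_cons.
apply: diff_op_commutator_lin => // {IH}; elim/mnm_ind: m => [|i m IH].
  apply: diff_op_ext (diff_op0 _ t) => f.
  by rewrite /commutator face_monomial0 !mul1r subrr.
by rewrite face_monomialD; apply: diff_op_commutatorM.
Qed.

(** By induction on the order the commutators with the variables vanish, so [d]
    is [R]-linear, hence multiplication by its symbol at the empty word. *)
Lemma diff_op_eq0 t d : diff_op_le (K := K) t d ->
  (forall w, var_commutator d w 1 = 0) -> d = fun=> 0.
Proof.
elim: t d => [|t IH] d dt d0.
  apply: funext => f; have := d0 [::]; case: dt => r dr /=.
  by rewrite dr mulr1 dr => ->; rewrite mul0r.
have dC i f : d (face_monomial U_(i) * f) = face_monomial U_(i) * d f.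
  apply/eqP; rewrite -subr_eq0; apply/eqP.
  rewrite -/(commutator (K := K) d (face_monomial U_(i)) f) (IH _ (dt.2 _)) // => w.
  exact: (d0 (i :: w)).
apply: (linear_eq_monomials dt.1) => [|m]; first exact: zero_fun_linear.
elim/mnm_ind: m => [|i m IHm]; first by rewrite face_monomial0; exact: (d0 [::]).
by rewrite face_monomialD dC IHm mulr0.
Qed.

End FaceRingMonomials.

(** * Operators with a single symbol *)

Section SingleSymbol.
Variables (K : fieldType) (n : nat) (Delta : simplicial_complex n).
Local Notation R := (face_ring K Delta).
Local Notation mono m := (face_monomial K Delta m).
Local Notation comm := (commutator (K := K)).
Local Notation var_comm := (@var_commutator K n Delta).
Implicit Types (m a b c y : 'X_{1..n}) (z : R) (d e : R -> R).

(** [d] is given on monomials by the formula for [z] times the divided power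
    operator of exponent [b].  Only its values on monomials of [R] are used
    because the divided power operator alone need not act on [R].  The truncated
    subtraction is harmless: the binomial vanishes unless [b <= a]. *)
Definition acts_like z b d :=
  forall a, d (mono a) = (mnm_bin a b)%:R * (z * mono (a - b)%MM).

Lemma acts_like_mul z d : linear d -> acts_like z 0%MM d -> d = *%R z.
Proof.
move=> dL dz; apply: (linear_eq_monomials dL (mul_linear z)) => m.
by rewrite dz mnm_bin0 mul1r subm0.
Qed.

(** Pascal's rule, after cancelling the term of the binomial that multiplication
    by [x_i] on the left produces. *)
Lemma acts_like_commutator z b i d : acts_like z (U_(i) + b) d ->
  acts_like z b (comm d (mono U_(i))).
Proof.
move=> dz a; rewrite /commutator -face_monomialD !dz mnm_binS natrD mulrDl.
have -> : (U_(i) + a - (U_(i) + b) = a - b)%MM.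
  by apply/mnmP => j; rewrite !(mnmBE, mnmDE) subnDl.
suff -> : mono U_(i) * ((mnm_bin a (U_(i) + b))%:R * (z * mono (a - (U_(i) + b))%MM)) =
   (mnm_bin a (U_(i) + b))%:R * (z * mono (a - b)%MM) by rewrite addrAC subrr add0r.
have [lt_ab|le_ba] := ltnP (a i) (1 + b i).
  by rewrite (@mnm_bin_small _ i) ?mul0r ?mulr0 // mnmDE mnm1E eqxx.
rewrite mulrCA; congr (_ * _); rewrite mulrCA -face_monomialD; congr (_ * mono _).
apply/mnmP => j; rewrite !(mnmBE, mnmDE) mnm1E.
by case: eqP => [<-|_]; rewrite ?add0n // subnDA subnAC subnKC // subn_gt0.
Qed.

Lemma acts_like_commutator0 z b i d : b i = 0%N -> acts_like z b d ->
  acts_like 0 b (comm d (mono U_(i))).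
Proof.
move=> bi dz a; rewrite /commutator -face_monomialD !dz mnm_bin_var //.
have -> : (U_(i) + a - b = U_(i) + (a - b))%MM.
  apply/mnmP => j; rewrite !(mnmBE, mnmDE) mnm1E.
  by case: eqP => [<-|//]; rewrite bi !subn0.
by rewrite face_monomialD 2!(mulrCA (mono U_(i))) subrr mul0r mulr0.
Qed.

Lemma acts_like_var_commutator z b d w : acts_like z b d ->
  var_comm d w 1 = (word_mnm w == b)%:R * z.
Proof.
elim: w z b d => [|i w IH] z b d dz.
  rewrite /word_mnm big_nil /= -(face_monomial0 K Delta) dz.
  have [<-|b0] := eqVneq 0%MM b; first by rewrite mnm_bin0 subm0 face_monomial0 mulr1.
  rewrite eq_sym in b0; have [i bi] := mnm_neq0 b0.
  by rewrite (@mnm_bin_small _ i) ?mul0r // mnm0E lt0n.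
rewrite /= /word_mnm big_cons -/(word_mnm w).
have [bi|bi] := eqVneq (b i) 0%N.
  rewrite -/(var_comm _ w) (IH 0 b) ?mulr0; last exact: acts_like_commutator0 dz.
  case: eqP => [E|]; last by rewrite mul0r.
  by move: bi; rewrite -E mnmDE mnm1E eqxx.
move: dz; rewrite -(mnm_varK bi) eqm_add2l => /acts_like_commutator /IH.
exact.
Qed.

Lemma acts_like_diff_op z b d : linear d -> acts_like z b d -> diff_op (K := K) d.
Proof.
move=> dL dz; move: {2}(mdeg b) (erefl (mdeg b)) => t bt; exists t.
elim: t b bt z d dL dz => [|t IH] b bt z d dL dz.
  move/eqP: bt; rewrite mdeg_eq0 => /eqP b0; rewrite b0 in dz.
  by exists z => f; rewrite (acts_like_mul dL dz).
apply: diff_op_le_vars => // i.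
have cL := commutator_linear (mono U_(i)) dL.
have [bi|bi] := eqVneq (b i) 0%N.
  apply: diff_op_ext (diff_op0 _ t) => f.
  rewrite (linear_eq_monomials cL (@zero_fun_linear _ _)) // => m.
  by rewrite (acts_like_commutator0 bi dz) mul0r mulr0.
move: dz; rewrite -{1}(mnm_varK bi) => /acts_like_commutator; apply: IH => //.
by move: bt; rewrite -{1}(mnm_varK bi) mdegD mdeg1 add1n => -[].
Qed.

Lemma acts_like_x_divided_partial i t :
  acts_like (mono U_(i)) (U_(i) *+ t)%MM (x_divided_partial_face K Delta i t).
Proof.
move=> a; rewrite x_divided_partial_faceE /x_divided_partial divided_partialX.
rewrite mulrnAr raddfMn /= rmorphM mulr_natl; congr (_ *+ _).
rewrite (mnm_binD1 i) big1 ?muln1 => [|j /negPf ji].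
  by rewrite mulmnE mnm1E eqxx mul1n.
by rewrite mulmnE mnm1E eq_sym ji mul0n bin0.
Qed.

Lemma x_divided_partial_face_linear i t : linear (x_divided_partial_face K Delta i t).
Proof.
move=> c f g; rewrite -[f]face_proj_surj -[g]face_proj_surj -face_projZ -rmorphD.
by rewrite !x_divided_partial_faceE linearP rmorphD /= face_projZ.
Qed.

Lemma x_divided_partial_face_diff_op i t :
  diff_op (K := K) (x_divided_partial_face K Delta i t).
Proof.
apply: acts_like_diff_op; first exact: x_divided_partial_face_linear.
exact: acts_like_x_divided_partial.
Qed.

(** Both conditions on [i] say that [x_i] is a new variable: then the exponent of
    [x_i] seen by the outer operator is the original one, and the two operators
    compose as if they acted on separate variables. *)
Lemma acts_like_x_comp y c i t e : y i = 0%N -> c i = 0%N ->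
  acts_like (mono y) c e ->
  acts_like (mono (U_(i) + y)%MM) (U_(i) *+ t + c)%MM
    (x_divided_partial_face K Delta i t \o e).
Proof.
move=> yi ci ez a.
have dL := x_divided_partial_face_linear i t.
rewrite /= ez mulr_natl -scaler_nat (linear_funZ dL) -face_monomialD.
rewrite acts_like_x_divided_partial scaler_nat -[LHS]mulr_natl [LHS]mulrA -natrM.
have -> : (mnm_bin a c * mnm_bin (y + (a - c))%MM (U_(i) *+ t))%N =
          mnm_bin a (U_(i) *+ t + c).
  rewrite !(mnm_binD1 i) !(mnmDE, mnmBE, mulmnE, mnm1E) eqxx yi ci bin0 subn0 mul1n addn0 mul1n.
  rewrite [X in (_ * (_ * X))%N]big1 => [|j /negPf ji].
    rewrite add0n muln1 mulnC; congr (_ * _)%N; apply: eq_bigr => j /negPf ji.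
    by rewrite mnmDE mulmnE mnm1E eq_sym ji mul0n add0n.
  by rewrite mulmnE mnm1E eq_sym ji mul0n bin0.
have [lt_at|le_ta] := ltnP (a i) t.
  by rewrite (@mnm_bin_small _ i) ?mul0r // mnmDE mulmnE mnm1E eqxx mul1n ci addn0.
congr (_ * _); rewrite -!face_monomialD; congr (mono _).
apply/mnmP => j; rewrite !(mnmDE, mnmBE, mulmnE, mnm1E).
case: eqP => [<-|_]; last by rewrite !mul0n !add0n subn0.
by rewrite yi ci !mul1n !add0n !addn0 subn0.
Qed.

Definition euler_op b : R -> R :=
  foldr (fun i d => x_divided_partial_face K Delta i (b i) \o d) id (enum (mnm_supp b)).

Lemma euler_op_acts_like b : acts_like (mono (mnm_indic (mnm_supp b))) b (euler_op b).
Proof.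
rewrite /euler_op /mnm_indic -big_enum.
have {2}-> : b = (\sum_(i <- enum (mnm_supp b)) U_(i) *+ b i)%MM.
  rewrite big_enum [LHS]multinomUE_id [RHS]big_mkcond; apply: eq_bigr => i _.
  by rewrite inE; case: eqP => //= ->; rewrite mulm0n.
have off s i (F : 'I_n -> nat) : i \notin s -> (\sum_(j <- s) U_(j) *+ F j)%MM i = 0%N.
  move=> iNs; rewrite mnm_sumE big_seq big1 // => j js.
  by rewrite mulmnE mnm1E; case: eqP iNs => // <-; rewrite js.
elim: (enum _) (enum_uniq (mnm_supp b)) => [_|i s IH /= /andP [iNs us]].
  by move=> a; rewrite !big_nil mnm_bin0 face_monomial0 !mul1r subm0.
rewrite !big_cons; apply: acts_like_x_comp; last exact: IH.
- have <- : (\sum_(j <- s) U_(j) *+ 1 = \sum_(j <- s) U_(j))%MM.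
    by apply: eq_bigr => j _; rewrite mulm1n.
  exact: off.
- exact: off.
Qed.

End SingleSymbol.

(** * Generation *)

Section Generation.
Variables (K : fieldType) (n : nat) (Delta : simplicial_complex n).
Local Notation R := (face_ring K Delta).
Local Notation gen := (generated (K := K)
    (fun theta : R -> R =>
       exists (i : 'I_n) (t : nat), theta = x_divided_partial_face K Delta i t)).

Lemma generated_euler_op b : gen (euler_op b).
Proof.
rewrite /euler_op; elim: (enum _) => [|i s IH] /=.
  by apply: gen_ext (gen_mul _ 1) => f; rewrite mul1r.
by apply: gen_comp IH; apply: gen_op; exists i, (b i).
Qed.

Lemma generated_sum (J : Type) (l : seq J) (c : J -> R) (d : J -> R -> R) :
  (forall j, gen (d j)) -> gen (fun f => \sum_(j <- l) c j * d j f).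
Proof.
move=> gd; elim: l => [|j l IH].
  by apply: gen_ext (gen_mul _ 0) => f; rewrite big_nil mul0r.
apply: gen_ext (gen_add (gen_comp (gen_mul _ (c j)) (gd j)) IH) => f.
by rewrite big_cons.
Qed.

(** The symbol of [d] at each exponent [b] is a multiple [s b] of
    [x^(supp b)], so the combination of the [euler_op b] with coefficients [s b]
    has the same symbols as [d]. *)
Lemma diff_op_generated t (d : R -> R) :
  T_space Delta -> diff_op_le (K := K) t d -> gen d.
Proof.
move=> hT dt.
have /choice [s sP] b : exists s, var_commutator d (mnm_word b) 1 =
    s * face_monomial K Delta (mnm_indic (mnm_supp b)).
  apply: T_space_divisible => // H HH /subsetPn [i]; rewrite inE => bi iH.
  by apply: (facet_kills_commutator dt HH iH); exact: mem_mnm_word.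
(* Symbols of words longer than the order vanish, so exponents of degree at
   most t suffice. *)
pose e (f : R) := \sum_(b : 'X_{1..n < t.+1}) s b * euler_op b f.
have ge : gen e by apply: generated_sum => b; exact: generated_euler_op.
have [u eu] : diff_op (K := K) e.
  apply: generated_diff_op ge => _ [i [k ->]].
  exact: x_divided_partial_face_diff_op.
suff E : (fun f => d f - e f) = fun=> 0.
  apply: gen_ext ge => f; have /eqP := congr1 (@^~ f) E.
  by rewrite subr_eq0 => /eqP ->.
have : diff_op_le (K := K) (maxn t u) (fun f => d f - e f).
  have eN : diff_op_le (K := K) u ( *%R (-1) \o e).
    by apply: (diff_op_comp (t := 0%N)) eu; exists (-1).
  apply: diff_op_ext (diff_op_add (diff_op_le_trans (leq_maxl _ _) dt)
    (diff_op_le_trans (leq_maxr _ _) eN)) => f /=.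
  by rewrite mulN1r.
move/diff_op_eq0; apply=> w.
rewrite /var_commutator iter_commutatorB iter_commutator_sum.
under eq_bigr => b _ do rewrite -/(var_commutator _ _ _)
  (acts_like_var_commutator _ (euler_op_acts_like K Delta b)) mulrCA -sP.
have [ltw|lew] := ltnP t (size w).
  rewrite (iter_commutator_long _ ltw dt) big1 ?subr0 // => b _.
  case: eqP => [E|]; last by rewrite mul0r.
  by have := bmdeg b; rewrite -E mdeg_word_mnm ltnS leqNgt ltw.
have wt : (mdeg (word_mnm w) < t.+1)%N by rewrite mdeg_word_mnm.
rewrite (bigD1 (BMultinom wt)) //= eqxx mul1r big1 => [|b Nb].
  by rewrite addr0 /var_commutator (iter_commutator_perm _ _ (perm_mnm_word w)) subrr.
case: eqP => [E|]; last by rewrite mul0r.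
by case/eqP: Nb; apply: val_inj.
Qed.

End Generation.

Unset Implicit Arguments.
Local Close Scope ring_scope.

Theorem theorem3p1 (K : fieldType) (n : nat) (Delta : simplicial_complex n)
    (hT : T_space Delta) (delta : face_ring K Delta -> face_ring K Delta) :
  diff_op (K := K) delta <->
  generated (K := K)
    (fun theta : face_ring K Delta -> face_ring K Delta =>
       exists (i : 'I_n) (t : nat), theta = x_divided_partial_face K Delta i t)
    delta.
Proof.
split=> [[t dt]|]; first exact: diff_op_generated hT dt.
by apply: generated_diff_op => _ [i [t ->]]; exact: x_divided_partial_face_diff_op.
Qed.
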